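(* Let $M=M_1\times_fM_2$ be a Lyra twisted warped product with scale $\varphi$, $k=\ln f$, $\sigma=\ln\varphi$, $n_i=\dim M_i$, $n=n_1+n_2>2$. Assume $k=k_1+k_2$ and $\sigma=\sigma_1+\sigma_2$ with $k_1,\sigma_1\in C^\infty(M_1)$ and $k_2,\sigma_2\in C^\infty(M_2)$. Then the mixed soliton equation $$(n_2-1)XU(k)+(n-2)\big[XU(\sigma)-X(k)U(\sigma)-X(\sigma)U(\sigma)\big]=0\quad\text{for all horizontal lifts }X\text{ and vertical lifts }U$$ is equivalent to $$X(k_1+\sigma_1)\,U(\sigma_2)=0\quad\text{for all }X\in\Gamma(TM_1),\ U\in\Gamma(TM_2).$$ Consequently, when this equation holds, on every connected open set on which $d\sigma_2\neq0$ one has $d(k_1+\sigma_1)=0$; equivalently $k_1+\sigma_1=C$ for a constant $C$, and hence, with $f_1=e^{k_1}$ and $\varphi_1=e^{\sigma_1}$, $$f_1\varphi_1=e^C .$$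
   Context: Lyra twisted warped product: $(M_1,g_1),(M_2,g_2)$ are smooth pseudo-Riemannian manifolds of positive dimensions; $f,\varphi:M_1\times M_2\to(0,\infty)$ are smooth; $M=M_1\times M_2$ carries $g=g_1\oplus f^2g_2$ and $g_L=\varphi^2g$. Horizontal (vertical) lifts are canonical lifts to $M$ of vector fields on $M_1$ ($M_2$); $XU(h)=X(U(h))$. Functions on a factor are identified with their pull-backs to $M$. The displayed mixed soliton equation is the horizontal--vertical component $\operatorname{Ric}^L(X,U)=0$ of the Lyra almost Ricci--Bourguignon soliton equation $\operatorname{Ric}^L+\frac12\mathcal L_Zg_L=(\lambda+\rho R^L)g_L$ with projectable potential $Z=Z_1+Z_2$ (a sum of lifts from the factors); $\operatorname{Ric}^L,R^L$ are the Ricci tensor and scalar curvature of $g_L$. *)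

(* Defs.v *)
From HB Require Import structures.
From mathcomp Require Import all_boot all_order all_algebra.
From mathcomp Require Import all_classical all_reals.
From mathcomp Require Import interval_inference topology normedtype landau derive exp.

Set Implicit Arguments.
Unset Strict Implicit.
Unset Printing Implicit Defensive.

Import Order.TTheory GRing.Theory Num.Theory.
Import numFieldNormedType.Exports.

Local Open Scope classical_set_scope.
Local Open Scope ring_scope.

Section smooth_maps.
Context {R : realType}.

(* In finite dimension this is the usual notion of a C^k map on an open set
   U: f is differentiable on U and all its directional derivatives are
   C^(k-1) on U. *)
Fixpoint Ck {E F : normedModType R} (k : nat) (U : set E) (f : E -> F) : Prop :=
  match k with
  | 0 => forall x, U x -> {for x, continuous f}
  | k'.+1 => (forall x, U x -> differentiable f x) /\
             (forall v : E, Ck k' U (fun x => 'D_v f x))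
  end.

Definition smooth_on {E F : normedModType R} (U : set E) (f : E -> F) : Prop :=
  forall k, Ck k U f.

Lemma near_eq_shift (E : normedModType R) (x : E) (P : set E) :
  (\forall y \near x, P y) -> \forall h \near 0, P (h + x).
Proof. by move=> xP; move: (xP); rewrite (near_shift 0 x) subr0. Qed.

Lemma near_eq_diff (E F : normedModType R) (f g : E -> F) (x : E) :
  (\forall y \near x, f y = g y) -> differentiable f x ->
  differentiable g x /\ 'd g x = 'd f x :> (E -> F).
Proof.
move=> fg df; have fgx : f x = g x := nbhs_singleton fg.
have dgE : g \o shift x = cst (g x) + 'd f x +o_ 0 id.
  apply/eqaddoP => _/posnumP[e].
  have : f \o shift x = cst (f x) + 'd f x +o_ 0 id by exact: diff_locally.
  move=> /eqaddoP/(_ e%:num (gt0 e)) H.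
  have fg0 := near_eq_shift fg.
  near=> h.
  have <- : (f \o shift x - (cst (f x) + 'd f x)) h =
            (g \o shift x - (cst (g x) + 'd f x)) h.
    rewrite !fctE /=; congr (_ - (_ + _)); last exact: fgx.
    by near: h.
  by near: h; exact: H.
have dfc : continuous ('d f x) by exact: diff_continuous.
have dE := diff_unique dfc dgE.
by split=> //; apply/diff_locallyP; rewrite dE.
Unshelve. all: by end_near. Qed.

Lemma near_eq_derive (E F : normedModType R) (f g : E -> F) (x v : E) :
  (\forall y \near x, f y = g y) -> differentiable f x -> 'D_v f x = 'D_v g x.
Proof.
move=> fg df; have [dg dE] := near_eq_diff fg df.
by rewrite !deriveE// dE.
Qed.

Lemma eq_Ck (E F : normedModType R) k (U : set E) (f g : E -> F) :
  open U -> (forall x, U x -> f x = g x) -> Ck k U f -> Ck k U g.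
Proof.
move=> oU; have nU x : U x -> \forall y \near x, U y by move=> Ux; exact: open_nbhs_nbhs.
elim: k f g => [|k IH] f g fg.
  move=> cf x Ux; rewrite /prop_for /continuous_at -fg//.
  apply: cvg_trans (cf x Ux); apply: near_eq_cvg.
  by near=> y; apply: fg; near: y; exact: nU.
move=> [df Df]; have fgx x : U x -> \forall y \near x, f y = g y.
  by move=> Ux; near=> y; apply: fg; near: y; exact: nU.
split=> [x Ux|v]; first by have [] := near_eq_diff (fgx x Ux) (df x Ux).
apply: IH (Df v) => x Ux; apply: near_eq_derive; [exact: fgx|exact: df].
Unshelve. all: by end_near. Qed.

Lemma Ck_comp_fst (E1 E2 F : normedModType R) k (U : set E1) (f : E1 -> F) :
  Ck k U f -> Ck k (U `*` setT) (fun x : E1 * E2 => f x.1).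
Proof.
elim: k f => [|k IH] f /=.
  by move=> cf x [Ux _]; apply: continuous_comp; [exact: cvg_fst|exact: cf].
move=> [df Df]; split=> [x [Ux _]|v]; last exact: IH (Df v.1).
apply: (@differentiable_comp _ _ _ _ fst f); last exact: df.
by apply: linear_differentiable => z; exact: cvg_fst.
Qed.

Lemma Ck_comp_snd (E1 E2 F : normedModType R) k (U : set E2) (f : E2 -> F) :
  Ck k U f -> Ck k (setT `*` U) (fun x : E1 * E2 => f x.2).
Proof.
elim: k f => [|k IH] f /=.
  by move=> cf x [_ Ux]; apply: continuous_comp; [exact: cvg_snd|exact: cf].
move=> [df Df]; split=> [x [_ Ux]|v]; last exact: IH (Df v.2).
apply: (@differentiable_comp _ _ _ _ snd f); last exact: df.
by apply: linear_differentiable => z; exact: cvg_snd.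
Qed.

Lemma Ck_subset (E F : normedModType R) k (U V : set E) (f : E -> F) :
  U `<=` V -> Ck k V f -> Ck k U f.
Proof.
move=> UV; elim: k f => [|k IH] f /=; first by move=> cf x /UV; exact: cf.
by move=> [df Df]; split=> [x /UV|v]; [exact: df|exact/IH/Df].
Qed.

Lemma Ck_pair (E F1 F2 : normedModType R) k (U : set E)
    (f : E -> F1) (g : E -> F2) :
  open U -> Ck k U f -> Ck k U g -> Ck k U (fun x => (f x, g x)).
Proof.
move=> oU; elim: k f g => [|k IH] f g /=.
  by move=> cf cg x Ux; apply: cvg_pair; [exact: cf|exact: cg].
move=> [df Df] [dg Dg]; split=> [x Ux|v].
  by apply: differentiable_pair; [exact: df|exact: dg].
apply: (@eq_Ck _ _ _ _ (fun x => ('D_v f x, 'D_v g x))) => //.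
  move=> x Ux; have dfx := df x Ux; have dgx := dg x Ux.
  rewrite !deriveE//; last exact: differentiable_pair.
  by rewrite diff_pair.
exact: IH.
Qed.

Lemma openX (S T : topologicalType) (A : set S) (B : set T) :
  open A -> open B -> open (A `*` B).
Proof.
move=> oA oB; rewrite openE => -[x y] [/= Ax By]; exists (A, B) => //=.
by split; exact: open_nbhs_nbhs.
Qed.

Lemma smooth_onX (E1 E2 F1 F2 : normedModType R) (U : set E1) (V : set E2)
    (f : E1 -> F1) (g : E2 -> F2) :
  open U -> open V -> smooth_on U f -> smooth_on V g ->
  smooth_on (U `*` V) (fun x => (f x.1, g x.2)).
Proof.
move=> oU oV sf sg k; apply: Ck_pair; first exact: openX.
  by apply: (Ck_subset _ (Ck_comp_fst E2 (sf k))) => x [].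
by apply: (Ck_subset _ (Ck_comp_snd E1 (sg k))) => x [].
Qed.
End smooth_maps.

Section manifolds.
Context {R : realType}.

(* cfun is a homeomorphism of cdom onto ccod with inverse cinv; its values
   outside of cdom, and those of cinv outside of ccod, are junk. *)
Record chart (M : topologicalType) (E : normedModType R) := Chart {
  cdom : set M;
  ccod : set E;
  cfun : M -> E;
  cinv : E -> M;
  cdom_open : open cdom;
  ccod_open : open ccod;
  cfun_cod : forall p, cdom p -> ccod (cfun p);
  cinv_dom : forall y, ccod y -> cdom (cinv y);
  cfunK : forall p, cdom p -> cinv (cfun p) = p;
  cinvK : forall y, ccod y -> cfun (cinv y) = y;
  cfun_cts : forall p, cdom p -> {for p, continuous cfun};
  cinv_cts : forall y, ccod y -> {for y, continuous cinv} }.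

Definition transition {M : topologicalType} {E : normedModType R}
  (c c' : chart M E) : E -> E := cfun c' \o cinv c.

Definition transition_dom {M : topologicalType} {E : normedModType R}
  (c c' : chart M E) : set E := ccod c `&` cinv c @^-1` cdom c'.

(* The atlas need not be maximal. A preferred chart chart_at p is recorded at
   every point p; it serves to identify the tangent space T_p M with the model
   space E. *)
Record smooth_manifold (M : topologicalType) (E : normedModType R) :=
  SmoothManifold {
  mfd_hausdorff : hausdorff_space M;
  mfd_second_countable : @second_countable M;
  atlas : set (chart M E);
  transition_smooth : forall c c', atlas c -> atlas c' ->
    smooth_on (transition_dom c c') (transition c c');
  chart_at : M -> chart M E;
  chart_at_atlas : forall p, atlas (chart_at p);
  chart_at_dom : forall p, cdom (chart_at p) p }.

Lemma transition_dom_open (M : topologicalType) (E : normedModType R)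
  (c c' : chart M E) : open (transition_dom c c').
Proof.
rewrite openE => y [cy /= cy'].
have H : nbhs y (ccod c) by apply: open_nbhs_nbhs; split=> //; exact: ccod_open.
apply: filterI => //; apply: (cinv_cts cy); apply: open_nbhs_nbhs.
by split=> //; exact: cdom_open.
Qed.

Section product.
Context {M1 M2 : topologicalType} {E1 E2 : normedModType R}.

Definition chart_prod (c1 : chart M1 E1) (c2 : chart M2 E2) :
  chart (M1 * M2)%type (E1 * E2)%type.
Proof.
refine (@Chart _ _ (cdom c1 `*` cdom c2) (ccod c1 `*` ccod c2)
  (fun p => (cfun c1 p.1, cfun c2 p.2)) (fun y => (cinv c1 y.1, cinv c2 y.2))
  _ _ _ _ _ _ _ _).
- by apply: openX; exact: cdom_open.
- by apply: openX; exact: ccod_open.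
- by move=> p [p1 p2]; split; exact: cfun_cod.
- by move=> y [y1 y2]; split; exact: cinv_dom.
- by move=> [p1 p2] [/= d1 d2]; rewrite !cfunK.
- by move=> [y1 y2] [/= d1 d2]; rewrite !cinvK.
- move=> p [p1 p2]; apply: cvg_pair => /=.
    by apply: continuous_comp; [exact: cvg_fst|exact: cfun_cts].
  by apply: continuous_comp; [exact: cvg_snd|exact: cfun_cts].
- move=> p [p1 p2]; apply: cvg_pair => /=.
    by apply: continuous_comp; [exact: cvg_fst|exact: cinv_cts].
  by apply: continuous_comp; [exact: cvg_snd|exact: cinv_cts].
Defined.

Lemma hausdorffX : hausdorff_space M1 -> hausdorff_space M2 ->
  hausdorff_space (M1 * M2)%type.
Proof.
move=> h1 h2 [p1 p2] [q1 q2] pq; congr (_, _).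
  apply: h1 => A B nA nB; have [||[z1 z2] [Az Bz]] := pq (fst @^-1` A) (fst @^-1` B).
  - exact: (@cvg_fst _ _ (nbhs p1) (nbhs p2) _ A nA).
  - exact: (@cvg_fst _ _ (nbhs q1) (nbhs q2) _ B nB).
  by exists z1.
apply: h2 => A B nA nB; have [||[z1 z2] [Az Bz]] := pq (snd @^-1` A) (snd @^-1` B).
- exact: (@cvg_snd _ _ (nbhs p1) (nbhs p2) _ A nA).
- exact: (@cvg_snd _ _ (nbhs q1) (nbhs q2) _ B nB).
by exists z2.
Qed.

Lemma second_countableX : @second_countable M1 -> @second_countable M2 ->
  @second_countable (M1 * M2)%type.
Proof.
move=> [B1 cB1 [oB1 bB1]] [B2 cB2 [oB2 bB2]].
exists ((fun AB => AB.1 `*` AB.2) @` (B1 `*` B2)).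
  exact: card_le_trans (card_image_le _ _) (countableX cB1 cB2).
split=> [_ [[A B] [/= BA BB] <-]|[x y] W [[U V] [/= nU nV] UV]].
  by apply: openX; [exact: oB1|exact: oB2].
have [A [BA Ax] AU] := bB1 x U nU; have [B [BB By] BV] := bB2 y V nV.
exists (A `*` B); first by split=> //; exists (A, B).
by move=> [a b] [/= Aa Bb]; apply: UV; split; [exact: AU|exact: BV].
Qed.

Definition manifold_prod (S1 : smooth_manifold M1 E1)
  (S2 : smooth_manifold M2 E2) : smooth_manifold (M1 * M2)%type (E1 * E2)%type.
Proof.
refine (@SmoothManifold _ _ _ _
  [set c | exists2 c1, atlas S1 c1 & exists2 c2, atlas S2 c2
                     & c = chart_prod c1 c2] _
  (fun p => chart_prod (chart_at S1 p.1) (chart_at S2 p.2)) _ _).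
- exact: hausdorffX (mfd_hausdorff S1) (mfd_hausdorff S2).
- exact: second_countableX (mfd_second_countable S1) (mfd_second_countable S2).
- move=> _ _ [c1 a1 [c2 a2 ->]] [d1 b1 [d2 b2 ->]] k.
  have s := smooth_onX (@transition_dom_open _ _ c1 d1)
    (@transition_dom_open _ _ c2 d2) (transition_smooth a1 b1)
    (transition_smooth a2 b2).
  by apply: (Ck_subset _ (s k)) => x [[? ?] [? ?]].
- move=> p; exists (chart_at S1 p.1); first exact: chart_at_atlas.
  by exists (chart_at S2 p.2) => //; exact: chart_at_atlas.
- by move=> p; split; exact: chart_at_dom.
Defined.
End product.

Section calculus.
Context {M : topologicalType} {E : normedModType R}.
Variable S : smooth_manifold M E.

Definition smooth_fun (h : M -> R) : Prop :=
  forall c, atlas S c -> smooth_on (ccod c) (h \o cinv c).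

(* dh_p as a linear form on T_p M, which is identified with E through the chart
   chart_at p *)
Definition differential (h : M -> R) (p : M) : E -> R :=
  'd (h \o cinv (chart_at S p)) (cfun (chart_at S p) p).

(* the components in the chart c of the tangent vector at p whose components in
   chart_at p are v *)
Definition components (c : chart M E) (p : M) (v : E) : E :=
  'd (transition (chart_at S p) c) (cfun (chart_at S p) p) v.

Definition smooth_vector_field (X : M -> E) : Prop :=
  forall c, atlas S c ->
    smooth_on (ccod c) (fun y => components c (cinv c y) (X (cinv c y))).

Definition vf_apply (X : M -> E) (h : M -> R) : M -> R :=
  fun p => differential h p (X p).

(* b is negative definite on some subspace of dimension m, spanned by the e i:
   the condition makes them linearly independent. *)
Definition neg_subspace (b : E -> E -> R) (m : nat) : Prop :=
  exists e : 'I_m -> E, forall a : 'I_m -> R, (exists i, a i != 0) ->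
    b (\sum_(i < m) a i *: e i) (\sum_(i < m) a i *: e i) < 0.

Definition has_index (b : E -> E -> R) (nu : nat) : Prop :=
  neg_subspace b nu /\ ~ neg_subspace b nu.+1.

Record pseudo_riemannian_metric := PseudoRiemannianMetric {
  metric :> M -> E -> E -> R;
  metric_linear : forall p u v w a,
    metric p (a *: u + v) w = a * metric p u w + metric p v w;
  metric_sym : forall p u v, metric p u v = metric p v u;
  metric_nondegenerate : forall p u, (forall v, metric p u v = 0) -> u = 0;
  metric_smooth : forall X Y, smooth_vector_field X -> smooth_vector_field Y ->
    smooth_fun (fun p => metric p (X p) (Y p));
  metric_index : exists nu, forall p, has_index (metric p) nu }.
End calculus.
End manifolds.

Section lyra_twisted_products.
Context {R : realType} {M1 M2 : topologicalType} {n1 n2 : nat}.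
Local Notation E1 := 'rV[R]_n1.
Local Notation E2 := 'rV[R]_n2.

(* In the charts chosen by manifold_prod, the tangent space of M1 * M2 at
   (p, q) is the product of those of M1 at p and of M2 at q. *)
Definition hlift (X : M1 -> E1) : M1 * M2 -> E1 * E2 := fun z => (X z.1, 0).
Definition vlift (U : M2 -> E2) : M1 * M2 -> E1 * E2 := fun z => (0, U z.2).

Record lyra_twisted_product (S1 : smooth_manifold M1 E1)
    (S2 : smooth_manifold M2 E2) := LyraTwistedProduct {
  factor_metric1 : pseudo_riemannian_metric S1;
  factor_metric2 : pseudo_riemannian_metric S2;
  twist : M1 * M2 -> R;
  scale : M1 * M2 -> R;
  twist_gt0 : forall z, 0 < twist z;
  scale_gt0 : forall z, 0 < scale z;
  twist_smooth : smooth_fun (manifold_prod S1 S2) twist;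
  scale_smooth : smooth_fun (manifold_prod S1 S2) scale }.

Context {S1 : smooth_manifold M1 E1} {S2 : smooth_manifold M2 E2}.
Variable L : lyra_twisted_product S1 S2.

Definition twisted_metric (z : M1 * M2) (u v : E1 * E2) : R :=
  factor_metric1 L z.1 u.1 v.1 + twist L z ^+ 2 * factor_metric2 L z.2 u.2 v.2.

Definition lyra_metric (z : M1 * M2) (u v : E1 * E2) : R :=
  scale L z ^+ 2 * twisted_metric z u v.

(* Up to sign, the left-hand side is the component Ric^L(X, U) of the Ricci
   tensor of lyra_metric. *)
Definition mixed_soliton_equation : Prop :=
  let n := (n1 + n2)%N in
  let k := fun z => ln (twist L z) in
  let sigma := fun z => ln (scale L z) in
  let D := vf_apply (manifold_prod S1 S2) in
  forall (X : M1 -> E1) (U : M2 -> E2),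
  smooth_vector_field S1 X -> smooth_vector_field S2 U -> forall z,
    (n2%:R - 1) * D (hlift X) (D (vlift U) k) z
    + (n%:R - 2) * (D (hlift X) (D (vlift U) sigma) z
                    - D (hlift X) k z * D (vlift U) sigma z
                    - D (hlift X) sigma z * D (vlift U) sigma z) = 0.
End lyra_twisted_products.

(* Main.v *)
(* Both k and sigma are sums of functions of the factors, so XU(k) = XU(sigma) = 0
   and the mixed equation reads -(n - 2) X(k1 + sigma1) U(sigma2) = 0, where
   n > 2. Every tangent vector is the value of a smooth vector field (bump
   functions), so at a point where d sigma2 is nonzero all X(k1 + sigma1)
   vanish; a function with zero differential on a connected open set is
   constant there, by the mean value theorem in charts. *)
Require Import Defs.
From mathcomp Require Import all_boot all_order all_algebra.
From mathcomp Require Import all_classical all_reals.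
From mathcomp Require Import topology normedtype sequences derive exp.
From HB Require Import structures.
From mathcomp Require Import interval_inference realfun.
From mathcomp Require Import ring lra.

Set Implicit Arguments.
Unset Strict Implicit.
Unset Printing Implicit Defensive.

Import Order.TTheory GRing.Theory Num.Theory.
Import numFieldNormedType.Exports.

Local Open Scope classical_set_scope.
Local Open Scope ring_scope.

(** * Calculus of C^k maps *)

Section Ck_calculus.
Context {R : realType}.
Implicit Types E F : normedModType R.

Lemma scaler_is_bilinear F : bilinear_for
  (GRing.Scale.Law.clone _ _ *:%R _) (GRing.Scale.Law.clone _ _ *:%R _)
  (fun (a : R) (u : F) => a *: u).
Proof.
split=> [u'|u] a x y /=; first by rewrite scalerDl scalerA.
by rewrite scalerDr !scalerA mulrC.
Qed.

(** Scalar multiplication is a continuous bilinear map, so its differential is the Leibniz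
    expression. *)
Lemma is_diff_scaler2 F (p : R * F) :
  is_diff p (fun q : R * F => q.1 *: q.2) (fun q => p.1 *: q.2 + q.1 *: p.2).
Proof.
pose m := bilinear_isBilinear.Build R R F F _ _ _ (scaler_is_bilinear F).
pose s : {bilinear R -> F -> F} := HB.pack (fun (a : R) (u : F) => a *: u) m.
have cs : continuous (fun q : R * F => s q.1 q.2) by exact: scale_continuous.
split; first exact: (@differentiable_bilin _ _ _ _ s p cs).
exact: (@diff_bilin _ _ _ _ s p cs).
Qed.

Lemma differentiable_scale E F (a : E -> R) (f : E -> F) x :
  differentiable a x -> differentiable f x ->
  differentiable (fun z => a z *: f z) x.
Proof.
move=> da df; have [ds _] := @is_diff_scaler2 F (a x, f x).
exact: (@differentiable_comp _ _ _ _ (fun z => (a z, f z))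
  (fun q : R * F => q.1 *: q.2) _ (differentiable_pair da df) ds).
Qed.

Lemma derive_scale E F (a : E -> R) (f : E -> F) x v :
  differentiable a x -> differentiable f x ->
  'D_v (fun z => a z *: f z) x = a x *: 'D_v f x + 'D_v a x *: f x.
Proof.
move=> da df; have [ds dsE] := @is_diff_scaler2 F (a x, f x).
rewrite !deriveE //; last exact: differentiable_scale.
have dp := differentiable_pair da df.
rewrite (@diff_comp _ _ _ _ (fun z => (a z, f z))
  (fun q : R * F => q.1 *: q.2) _ dp ds) /= dsE.
by rewrite diff_pair.
Qed.

(** [Ck k.+1] asks only for differentiability, so [Ck 0] has to be recovered from it. Product and
    chain rules need this to lower the order of an underived factor. *)
Lemma Ck_le E F k j (U : set E) (f : E -> F) :
  (j <= k)%N -> Ck k U f -> Ck j U f.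
Proof.
elim: k j f => [|k IH] [|j] f //= jk [df Df].
  by move=> x Ux; exact/differentiable_continuous/df.
by split=> // v; exact: IH (Df v).
Qed.

Lemma Ck_cst E F k (U : set E) (c : F) : Ck k U (fun=> c).
Proof.
elim: k c => [|k IH] c /=; first by move=> x _; exact: cst_continuous.
split=> [x _|v]; first exact: differentiable_cst.
have -> : (fun x => 'D_v (fun=> c) x) = fun=> 0 :> F; last exact: IH.
by apply/funext => x; exact: derive_cst.
Qed.

Lemma CkD E F k (U : set E) (f g : E -> F) : open U ->
  Ck k U f -> Ck k U g -> Ck k U (fun x => f x + g x).
Proof.
move=> oU; elim: k f g => [|k IH] f g /=.
  by move=> cf cg x Ux; exact: cvgD (cf x Ux) (cg x Ux).
move=> [df Df] [dg Dg]; split=> [x Ux|v].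
  exact: differentiableD (df x Ux) (dg x Ux).
apply: (@eq_Ck _ _ _ _ _ (fun x => 'D_v f x + 'D_v g x)) => //; last exact: IH.
by move=> x Ux; rewrite -deriveD //; apply: diff_derivable; [exact: df|exact: dg].
Qed.

Lemma Ck_sum E F k (U : set E) n (f : 'I_n -> E -> F) : open U ->
  (forall i, Ck k U (f i)) -> Ck k U (fun x => \sum_(i < n) f i x).
Proof.
move=> oU; elim: n f => [|n IH] f Cf.
  rewrite (_ : (fun x => _) = fun=> 0); first exact: Ck_cst.
  by apply/funext => x; rewrite big_ord0.
rewrite (_ : (fun x => _) = fun x => \sum_(i < n) f (widen_ord (leqnSn n) i) x
  + f ord_max x); last by apply/funext => x; rewrite big_ord_recr.
by apply: CkD => //; exact: IH.
Qed.

Lemma Ck_scale E F k (U : set E) (a : E -> R) (f : E -> F) : open U ->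
  Ck k U a -> Ck k U f -> Ck k U (fun x => a x *: f x).
Proof.
move=> oU; elim: k a f => [|k IH] a f.
  by move=> ca cf x Ux; exact: cvgZ (ca x Ux) (cf x Ux).
move=> Ca Cf; case: (Ca) (Cf) => da Da [df Df]; split=> [x Ux|v].
  exact: differentiable_scale (da x Ux) (df x Ux).
apply: (@eq_Ck _ _ _ _ _ (fun x => a x *: 'D_v f x + 'D_v a x *: f x)) => //.
  by move=> x Ux; rewrite derive_scale //; [exact: da|exact: df].
have [Ca' Cf'] := (Ck_le (leqnSn k) Ca, Ck_le (leqnSn k) Cf).
by apply: CkD => //; apply: IH => //; [exact: Df|exact: Da].
Qed.

Lemma derive_coord E n (f : E -> 'rV[R]_n) (i : 'I_n) x v : differentiable f x ->
  differentiable (fun y => f y 0 i : R) x /\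
  'D_v (fun y => f y 0 i : R) x = ('D_v f x) 0 i.
Proof.
have lin : linear (fun N : 'rV[R]_n => N 0 i : R) by move=> a u w; rewrite !mxE.
pose m := GRing.isLinear.Build _ _ _ _ _ lin.
pose l : {linear 'rV[R]_n -> R} := HB.pack (fun N : 'rV[R]_n => N 0 i : R) m.
have cl : continuous l by exact: coord_continuous.
move=> df; have dl := linear_differentiable (f x) cl.
have dlf : differentiable (l \o f) x by exact: differentiable_comp.
by split=> //; rewrite !deriveE // -[fun y => _]/(l \o f) diff_comp// diff_lin.
Qed.

Lemma Ck_coord E n k (U : set E) (f : E -> 'rV[R]_n) (i : 'I_n) : open U ->
  Ck k U f -> Ck k U (fun x => f x 0 i : R).
Proof.
move=> oU; elim: k f => [|k IH] f /=.
  move=> cf x Ux.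
  apply: (@continuous_comp _ _ _ f (fun N : 'rV[R]_n => N 0 i)); first exact: cf.
  exact: coord_continuous.
move=> [df Df]; split=> [x Ux|v].
  by have [] := derive_coord i 0 (df x Ux).
apply: (@eq_Ck _ _ _ _ _ (fun x => ('D_v f x) 0 i)) => //; last exact: IH.
by move=> x Ux; have [_ ->] := derive_coord i v (df x Ux).
Qed.

Lemma Ck_id E k (U : set E) : Ck k U id.
Proof.
case: k => [|k] /=; first by move=> x _.
split=> [x _|v]; first exact: ex_diff.
have -> : (fun x => 'D_v id x) = fun=> v :> E; last exact: Ck_cst.
by apply/funext => x; exact: derive_id.
Qed.

(** [Ck] controls derivatives in fixed directions only, whereas the chain rule differentiates [g] in
    the direction ['D_v f x], which varies with [x]. Expanding in the standard basis restores fixed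
    directions. *)
Lemma derive_comp_rV E F n (f : E -> 'rV[R]_n) (g : 'rV[R]_n -> F) x v :
  differentiable f x -> differentiable g (f x) ->
  'D_v (g \o f) x = \sum_(j < n) ('D_v f x) 0 j *: 'D_(delta_mx 0 j) g (f x).
Proof.
move=> df dg; rewrite !deriveE//; last exact: differentiable_comp.
rewrite diff_comp //= [in LHS](row_sum_delta ('d f x v)) linear_sum.
by apply: eq_bigr => j _; rewrite linearZ /= deriveE.
Qed.

Lemma Ck_comp E F n k (U : set E) (V : set 'rV[R]_n) (f : E -> 'rV[R]_n)
    (g : 'rV[R]_n -> F) : open U -> (forall x, U x -> V (f x)) ->
  Ck k U f -> Ck k V g -> Ck k U (g \o f).
Proof.
move=> oU UV; elim: k g => [|k IH] g.
  by move=> cf cg x Ux; apply: continuous_comp; [exact: cf|exact/cg/UV].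
move=> Cf [dg Dg]; case: (Cf) => df Df; split=> [x Ux|v].
  by apply: differentiable_comp; [exact: df|exact/dg/UV].
apply: (@eq_Ck _ _ _ _ _
  (fun x => \sum_(j < n) ('D_v f x) 0 j *: 'D_(delta_mx 0 j) g (f x))) => //.
  by move=> x Ux; rewrite (derive_comp_rV _ (df x Ux) (dg _ (UV x Ux))).
apply: Ck_sum => // j; apply: Ck_scale => //; first exact: Ck_coord (Df v).
exact: IH _ (Ck_le (leqnSn k) Cf) (Dg _).
Qed.

(** Each clause of [Ck] is a condition at single points of the set, with derivatives taken in the
    ambient space. *)
Lemma CkU E F k (U V : set E) (f : E -> F) :
  Ck k U f -> Ck k V f -> Ck k (U `|` V) f.
Proof.
elim: k f => [|k IH] f /=; first by move=> cU cV x [/cU|/cV].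
move=> [dU DU] [dV DV]; split=> [x [/dU|/dV]//|v]; exact: IH.
Qed.
End Ck_calculus.

(** * Bump functions *)

Section bump.
Context {R : realType}.

(* The derivative of flat m is flat (m + 2) - m flat (m + 1): the family is
   closed under differentiation, hence consists of smooth functions. *)
Definition flat (m : nat) (t : R) : R :=
  if 0 < t then t^-1 ^+ m * expR (- t^-1) else 0.

Lemma flat_gt0 m t : 0 < t -> 0 < flat m t.
Proof. by move=> t0; rewrite /flat t0 mulr_gt0 ?expR_gt0 ?exprn_gt0 ?invr_gt0. Qed.

Lemma flat_le0 m t : t <= 0 -> flat m t = 0.
Proof. by move=> t0; rewrite /flat ltNge t0. Qed.

Lemma flat_ge0 m t : 0 <= flat m t.
Proof. by have [/flat_le0->//|/(flat_gt0 m)/ltW] := leP t 0. Qed.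

(** With [s = t^-1], the exponential series gives [expR s >= s ^+ m.+2 / m.+2!]. The quadratic decay
    makes the derivative at 0 vanish. *)
Lemma flat_bound m t : flat m t <= m.+2`!%:R * t ^+ 2.
Proof.
have [t0|t0] := leP t 0; first by rewrite flat_le0// mulr_ge0// sqr_ge0.
rewrite /flat t0 expRN; have it0 : 0 < t^-1 by rewrite invr_gt0.
have f0 : 0 < m.+2`!%:R :> R by rewrite ltr0n fact_gt0.
have := @expR_ge1Dxn R t^-1 m.+1 (ltW it0) => le1.
have le2 : t^-1 ^+ m.+2 / m.+2`!%:R <= expR t^-1 by lra.
rewrite ler_pdivrMr ?expR_gt0//.
apply: le_trans (ler_wpM2l _ le2); last by rewrite mulr_ge0 ?sqr_ge0 ?ltW.
rewrite !exprS le_eqVlt; apply/orP; left; apply/eqP; field.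
by rewrite !gt_eqF.
Qed.

Lemma is_derive_flat m (t : R) :
  is_derive t 1 (flat m) (flat m.+2 t - m%:R * flat m.+1 t).
Proof.
have [t0|t0|->] := ltgtP t 0.
- rewrite !flat_le0 ?ltW// mulr0 subr0; apply: (near_eq_is_derive (f := cst 0)).
  by near=> s; rewrite flat_le0 //; apply: ltW; near: s; exact: lt_nbhsl.
- apply: (@near_eq_is_derive R R R (fun s => s^-1 ^+ m * expR (- s^-1))).
    by near=> s; rewrite /flat ifT //; near: s; exact: lt_nbhsr.
  have tn0 : t != 0 by rewrite gt_eqF.
  have di : is_derive t 1 (fun s : R => s^-1) (- t ^- 2 *: 1).
    exact: is_deriveV.
  have dN : is_derive t 1 (fun s : R => - s^-1) (- (- t ^- 2 *: 1)).
    exact: is_deriveN.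
  have dX : is_derive t 1 (fun s : R => s^-1 ^+ m)
      ((m%:R * t^-1 ^+ m.-1) *: (- t ^- 2 *: 1)).
    by have := is_deriveX m di; rewrite exprfctE.
  have dE : is_derive t 1 (fun s : R => expR (- s^-1))
      (expR (- t^-1) * (- (- t ^- 2 *: 1))).
    exact: is_derive1_comp.
  apply: is_derive_eq (is_deriveM dX dE) _.
  (* The derivative of the power has exponent [m.-1], so [m = 0] is treated apart. *)
  rewrite /flat t0 /GRing.scale /=; case: m {dX} => [|m] /=.
    by field.
  by rewrite !exprS; field.
rewrite !flat_le0 // mulr0 subr0.
suff c : (fun h => h^-1 *: ((flat m \o shift 0) (h *: 1) - flat m 0)) @ 0^' --> (0 : R).
  by split; [apply: cvgP c|apply: cvg_lim c].
(* At 0 the difference quotient is [flat m h / h], at most [m.+2! * |h|] in absolute value by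
   [flat_bound]. *)
apply: (@squeeze_cvgr _ _ _ _ (fun h => - (m.+2`!%:R * `|h|))
  (fun h => m.+2`!%:R * `|h|)).
- near=> h; rewrite flat_le0//= subr0 addr0 /GRing.scale /= mulr1.
  rewrite -ler_norml normrM normfV (ger0_norm (flat_ge0 _ _)).
  have hn0 : 0 < `|h| by rewrite normr_gt0; near: h; exact: nbhs_dnbhs_neq.
  rewrite ler_pdivrMl// (le_trans (flat_bound _ _))//.
  by rewrite [leRHS]mulrCA -expr2 real_normK ?num_real.
- rewrite -[X in _ --> X]oppr0; apply: cvgN; rewrite -[X in _ --> X](mulr0 m.+2`!%:R).
  apply: cvgMr; rewrite -[X in _ --> X](@normr0 R R).
  exact: cvg_within_filter (@norm_continuous _ _ _).
- rewrite -[X in _ --> X](mulr0 m.+2`!%:R).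
  apply: cvgMr; rewrite -[X in _ --> X](@normr0 R R).
  exact: cvg_within_filter (@norm_continuous _ _ _).
Unshelve. all: by end_near. Qed.

(** The induction on [k] is uniform in [m], since one derivative of [flat m] brings in [flat m.+1]
    and [flat m.+2]. *)
Lemma Ck_flat (E : normedModType R) k (U : set E) (q : E -> R) m : open U ->
  Ck k U q -> Ck k U (flat m \o q).
Proof.
move=> oU; have df j t : differentiable (flat j) t.
  by apply/derivable1_diffP; have [] := is_derive_flat j t.
elim: k m => [|k IH] m.
  move=> cq x Ux; apply: continuous_comp; first exact: cq.
  exact: differentiable_continuous.
move=> Cq; case: (Cq) => dq Dq; have Cq' := Ck_le (leqnSn k) Cq.
split=> [x Ux|v]; first by apply: differentiable_comp => //; exact: dq.
apply: (@eq_Ck _ _ _ _ _ (fun x =>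
  (flat m.+2 (q x) + - m%:R *: flat m.+1 (q x)) *: 'D_v q x)) => //.
  move=> x Ux; have dqx := dq x Ux; rewrite !deriveE//; last exact: differentiable_comp.
  rewrite (diff_comp dqx (df m (q x)))/= diff1E// derive1E.
  have [_ ->] := is_derive_flat m (q x).
  by rewrite /GRing.scale /= mulrC mulNr.
apply: Ck_scale => //; last exact: Dq.
apply: CkD => //; first exact: IH.
by apply: (@Ck_scale _ _ _ _ _ (fun=> - m%:R)) => //; [exact: Ck_cst|exact: IH].
Qed.

(* The Euclidean norm gives the bump because, unlike the sup norm of 'rV[R]_n,
   its square is smooth. *)
Lemma bump_rV n (x : 'rV[R]_n) (r : R) : 0 < r -> exists b : 'rV[R]_n -> R,
  [/\ smooth_on setT b, 0 < b x & forall y, b y != 0 -> `|y - x| <= r].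
Proof.
move=> r0; pose q (y : 'rV[R]_n) := r ^+ 2 - \sum_(i < n) (y 0 i - x 0 i) ^+ 2.
exists (flat 0 \o q); split.
- move=> k; apply: Ck_flat; first exact: openT.
  have Cy i : Ck k setT (fun y : 'rV[R]_n => y 0 i - x 0 i).
    apply: CkD; [exact: openT| |exact: Ck_cst].
    by apply: Ck_coord; [exact: openT|exact: Ck_id].
  have -> : q = fun y => r ^+ 2 + -1 *: \sum_(i < n) (y 0 i - x 0 i) *: (y 0 i - x 0 i).
    by apply/funext => y; rewrite /q scaleN1r; congr (_ - _); apply: eq_bigr.
  apply: CkD; [exact: openT|exact: Ck_cst|].
  apply: (@Ck_scale _ _ _ _ _ (fun=> -1)); [exact: openT|exact: Ck_cst|].
  by apply: Ck_sum => [|i]; [exact: openT|apply: Ck_scale => //; exact: openT].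
- apply: flat_gt0; rewrite /q big1 ?subr0 ?exprn_gt0// => i _.
  by rewrite subrr expr0n.
move=> y; apply: contra_neqT; rewrite -ltNge => ry.
apply: flat_le0; rewrite /q subr_le0.
(* If the sup norm exceeds [r], so does one coordinate; its square alone already makes [q y]
   nonpositive. *)
have [[i j] /= rij] : exists ij : 'I_1 * 'I_n, r < `|(y - x) ij.1 ij.2|.
  apply/existsP; apply: contraTT ry => /existsPn rn.
  rewrite -leNgt; rewrite /Num.norm /= mx_normrE; apply/bigmax_leP.
  split; first exact: ltW.
  by move=> ij _; rewrite leNgt.
rewrite (bigD1 j)//= -[leLHS]addr0 lerD//; last by apply: sumr_ge0 => *; exact: sqr_ge0.
rewrite -[leRHS]real_normK ?num_real// lerXn2r// ?nnegrE ?(ltW r0)//.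
by move: rij; rewrite !mxE (ord1 i) => /ltW.
Qed.
End bump.

(** * Smooth fields and functions on manifolds *)

Section manifold.
Context {R : realType} {M : topologicalType}.

Lemma open_cinv_preimage (E : normedModType R) (c : chart M E) (A : set M) :
  open A -> open (ccod c `&` cinv c @^-1` A).
Proof.
move=> oA; rewrite openE => y [cy /= Ay].
have H : nbhs y (ccod c) by apply: open_nbhs_nbhs; split=> //; exact: ccod_open.
by apply: filterI => //; apply: (cinv_cts cy); exact: open_nbhs_nbhs.
Qed.

Lemma transition_dom_cfun (E : normedModType R) (c c' : chart M E) p :
  cdom c p -> cdom c' p -> transition_dom c c' (cfun c p).
Proof. by move=> cp c'p; split; [exact: cfun_cod|rewrite /= cfunK]. Qed.

Lemma near_transition_dom (E : normedModType R) (c c' : chart M E) p :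
  cdom c p -> cdom c' p -> \forall y \near cfun c p, transition_dom c c' y.
Proof.
move=> cp c'p; apply: open_nbhs_nbhs; split; first exact: transition_dom_open.
exact: transition_dom_cfun.
Qed.

Lemma transitionK (E F : normedModType R) (c c' : chart M E) (h : M -> F) p :
  cdom c p -> cdom c' p ->
  \forall y \near cfun c p, ((h \o cinv c') \o transition c c') y = (h \o cinv c) y.
Proof.
move=> cp c'p; apply: filterS (near_transition_dom cp c'p) => y [_ /= c'y].
by rewrite /transition /= cfunK.
Qed.

Lemma transition_cfun (E : normedModType R) (c c' : chart M E) p :
  cdom c p -> transition c c' (cfun c p) = cfun c' p.
Proof. by move=> cp; rewrite /transition /= cfunK. Qed.

Variables (E : normedModType R) (S : smooth_manifold M E).

Lemma differentiable_transition (c c' : chart M E) p :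
  atlas S c -> atlas S c' -> cdom c p -> cdom c' p ->
  differentiable (transition c c') (cfun c p).
Proof.
move=> ac ac' cp c'p; have [dt _] := transition_smooth ac ac' 1%N.
exact/dt/transition_dom_cfun.
Qed.

(** This is the chain rule through the transition map. The target [F] is arbitrary so that [h] may
    also be a chart map, which yields the composition law for differentials of transitions. *)
Lemma diff_chart_change (F : normedModType R) (h : M -> F) (c c' : chart M E) p v :
  atlas S c -> atlas S c' -> cdom c p -> cdom c' p ->
  differentiable (h \o cinv c') (cfun c' p) ->
  'd (h \o cinv c) (cfun c p) v =
  'd (h \o cinv c') (cfun c' p) ('d (transition c c') (cfun c p) v).
Proof.
move=> ac ac' cp c'p dh; have dt := differentiable_transition ac ac' cp c'p.
rewrite -(transition_cfun c' cp) in dh *.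
have [_ ->] := near_eq_diff (transitionK h cp c'p) (differentiable_comp dt dh).
by rewrite diff_comp.
Qed.

Lemma diff_transition_id (c : chart M E) p v : cdom c p ->
  'd (transition c c) (cfun c p) v = v.
Proof.
move=> cp; have idE : \forall y \near cfun c p, id y = transition c c y.
  apply: filterS (near_transition_dom cp cp) => y [cy _].
  by rewrite /transition /= cinvK.
have did : differentiable id (cfun c p) by exact: ex_diff.
by have [_ ->] := near_eq_diff idE did; rewrite diff_val.
Qed.

Lemma smooth_fun_differentiable (h : M -> R) (c : chart M E) p :
  smooth_fun S h -> atlas S c -> cdom c p ->
  differentiable (h \o cinv c) (cfun c p).
Proof. by move=> sh ac cp; have [dh _] := sh c ac 1%N; exact/dh/cfun_cod. Qed.
End manifold.

(** * Extension of a tangent vector to a global smooth field *)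

Section vector_fields.
Context {R : realType} {M : topologicalType} {n : nat}.
Variable S : smooth_manifold M 'rV[R]_n.

(* X is a constant field of a chart multiplied by a bump function. Its extension
   by zero is smooth because M is Hausdorff: the compact support is closed. *)
Lemma exists_smooth_vector_field p0 (v : 'rV[R]_n) :
  exists2 X, smooth_vector_field S X & X p0 = v.
Proof.
pose c0 := chart_at S p0; pose x0 := cfun c0 p0.
have ac0 : atlas S c0 := chart_at_atlas S p0.
have cp0 : cdom c0 p0 := chart_at_dom S p0.
have [r rcod] : exists r : {posnum R}, closed_ball x0 r%:num `<=` ccod c0.
  apply/nbhs_closedballP/open_nbhs_nbhs; split; first exact: ccod_open.
  exact: cfun_cod.
have [b [sb b0 bsupp]] := bump_rV x0 (gt0 r).
(* This normalization cancels the value of the bump at [x0], so that [X p0 = v]. *)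
pose w := (b x0)^-1 *: v.
(* A field is valued at [p] in the components of [chart_at S p]; the differential of the transition
   carries the constant [w] of the chart [c0] there. *)
pose X p := if `[< cdom c0 p >] then
  b (cfun c0 p) *: 'd (transition c0 (chart_at S p)) (cfun c0 p) w else 0.
pose K := cinv c0 @` closed_ball x0 r%:num.
have clK : closed K.
  apply: compact_closed; first exact: mfd_hausdorff S.
  apply: continuous_compact.
    by apply: continuous_in_subspaceT => y /set_mem/rcod; exact: cinv_cts.
  apply: bounded_closed_compact; last exact: closed_ball_closed.
  rewrite closed_ballE//; exists (`|x0| + r%:num); split; first exact: num_real.
  move=> t lt y /= yr; apply: le_trans (ltW lt).
  by rewrite -[y](subrK x0) addrC (le_trans (ler_normD _ _))// lerD2l -normrN opprB.
have XK p : ~ K p -> X p = 0.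
  move=> nKp; rewrite /X; case: asboolP => // cp.
  have [->|/bsupp bp] := eqVneq (b (cfun c0 p)) 0; first by rewrite scale0r.
  case: nKp; exists (cfun c0 p); last exact: cfunK.
  by rewrite closed_ballE//= /closed_ball_ /= -normrN opprB.
exists X; last first.
  rewrite /X asboolT// -/x0 diff_transition_id// scalerA divff ?scale1r//.
  by rewrite gt_eqF.
move=> c ac k; pose U2 := ccod c `&` cinv c @^-1` ~` K.
(* Two open sets cover [ccod c]: the overlap with [c0], and the complement of [K], where [X] is
   zero. They cover because [K] lies in [cdom c0]. *)
apply: (@Ck_subset _ _ _ _ _ (transition_dom c c0 `|` U2)).
  move=> y cy; have [yc0|nyc0] := pselect (cdom c0 (cinv c y)); [by left|right].
  split=> //= -[z /rcod zc zy]; apply: nyc0; rewrite -zy; exact: cinv_dom.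
apply: CkU.
  (* By the chain rule the preferred charts, which may jump from point to point, drop out of the
     components in [c]. *)
  apply: (@eq_Ck _ _ _ _ _ (fun y => b (transition c c0 y) *:
    'D_w (transition c0 c) (transition c c0 y))).
  - exact: transition_dom_open.
  - move=> y [cy /= c0y]; rewrite /X asboolT// /components.
    set p := cinv c y; have pc : cdom c p by exact: cinv_dom.
    have ap := chart_at_atlas S p; have dp := chart_at_dom S p.
    rewrite linearZ/=; congr (_ *: _).
    rewrite deriveE; last exact: differentiable_transition ac0 ac c0y pc.
    have := differentiable_transition ap ac dp pc.
    exact: (@diff_chart_change _ _ _ S _ (cfun c) _ _ _ w ac0 ap c0y dp).
  - have tc := transition_smooth ac ac0 k.
    have oc := @transition_dom_open _ _ _ c c0.
    have tV y : transition_dom c c0 y -> transition_dom c0 c (transition c c0 y).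
      move=> [cy c0y]; split; first exact: cfun_cod.
      by rewrite /transition /= cfunK//; exact: cinv_dom.
    apply: Ck_scale => //.
      by apply: (@Ck_comp _ _ _ _ _ _ setT) => //; exact: sb.
    apply: (@Ck_comp _ _ _ _ _ _ (transition_dom c0 c)
      (transition c c0) (fun y => 'D_w (transition c0 c) y)) => //.
    by have [_] := transition_smooth ac0 ac k.+1; exact.
apply: (@eq_Ck _ _ _ _ _ (fun=> 0)); last exact: Ck_cst.
  by apply: open_cinv_preimage; exact: closed_openC.
by move=> y [_ /= Ky]; rewrite XK// /components linear0.
Qed.
End vector_fields.

(** * Derivatives along fields and functions with zero differential *)

Section smooth_functions.
Context {R : realType}.

(** In a chart, [X(h)] is the sum of the components of [X] times the partial derivatives of [h]. The
    derivative is itself differentiated later, in the mixed term [XU(h)]. *)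
Lemma smooth_vf_apply (M : topologicalType) n (S : smooth_manifold M 'rV[R]_n) X h :
  smooth_vector_field S X -> smooth_fun S h -> smooth_fun S (vf_apply S X h).
Proof.
move=> sX sh c ac k; have oc := ccod_open c.
apply: (@eq_Ck _ _ _ _ _ (fun y => \sum_(j < n)
  (components S c (cinv c y) (X (cinv c y))) 0 j *:
  'D_(delta_mx 0 j) (h \o cinv c) y)) => //.
  move=> y cy; set p := cinv c y; have pc : cdom c p by exact: cinv_dom.
  have ap := chart_at_atlas S p; have dp := chart_at_dom S p.
  have dh := smooth_fun_differentiable sh ac pc.
  rewrite /= -/p /vf_apply /differential (diff_chart_change (X p) ap ac dp pc dh).
  rewrite -/(components S c p (X p)) cinvK// in dh *.
  rewrite [in RHS](row_sum_delta (components S c p (X p))) linear_sum.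
  by apply: eq_bigr => j _; rewrite linearZ /= deriveE.
apply: Ck_sum => // j; apply: Ck_scale => //; first exact: Ck_coord (sX c ac k).
by have [_] := sh c ac k.+1; exact.
Qed.

Lemma smooth_funD (M : topologicalType) (E : normedModType R)
    (S : smooth_manifold M E) h g :
  smooth_fun S h -> smooth_fun S g -> smooth_fun S (fun x => h x + g x).
Proof.
move=> sh sg c ac k.
by apply: CkD; [exact: ccod_open|exact: sh|exact: sg].
Qed.

Lemma differentialD (M : topologicalType) (E : normedModType R)
    (S : smooth_manifold M E) h g p v : smooth_fun S h -> smooth_fun S g ->
  differential S (fun x => h x + g x) p v =
  differential S h p v + differential S g p v.
Proof.
move=> sh sg; have [ap dp] := (chart_at_atlas S p, chart_at_dom S p).
have dh := smooth_fun_differentiable sh ap dp.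
have dg := smooth_fun_differentiable sg ap dp.
by have := diffD dh dg => /(congr1 (@^~ v)).
Qed.

Lemma differential_locally_constant (M : topologicalType) (E : normedModType R)
    (S : smooth_manifold M E) h (A : set M) : smooth_fun S h -> open A ->
  (forall p, A p -> differential S h p = cst 0 :> (E -> R)) ->
  forall p, A p -> \forall q \near p, h q = h p.
Proof.
move=> sh oA dh0 p Ap; pose c := chart_at S p.
have [ac cp] : atlas S c /\ cdom c p := conj (chart_at_atlas S p) (chart_at_dom S p).
have /nbhs_ballP[r /= r0 rV] : \forall y \near cfun c p, (ccod c `&` cinv c @^-1` A) y.
  apply: open_nbhs_nbhs; split; first exact: open_cinv_preimage.
  by split; [exact: cfun_cod|rewrite /= cfunK].
pose F := h \o cinv c.
(* The hypothesis concerns a different preferred chart at each point; the change of chart moves it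
   to the fixed chart [c]. *)
have dF y : ball (cfun c p) r y -> is_diff y F 0.
  move=> /rV[cy /= Ay]; set q := cinv c y; have qc : cdom c q by exact: cinv_dom.
  have [aq dq] := (chart_at_atlas S q, chart_at_dom S q).
  have dFy := smooth_fun_differentiable sh ac qc.
  have dhq := smooth_fun_differentiable sh aq dq.
  split; first by rewrite -[y](cinvK cy).
  apply/funext => v; rewrite -[y in LHS](cinvK cy).
  rewrite (diff_chart_change v ac aq qc dq dhq).
  by rewrite -/(differential S h q _) dh0.
have Fcst y : ball (cfun c p) r y -> F y = F (cfun c p).
  (* The segment from [x] to [y] stays in the ball, so [F \o l] has zero derivative on [0, 1] and
     the mean value theorem applies. *)
  set x := cfun c p => xy; pose l (t : R) := t *: (y - x) + x.
  have lb (t : R) : t \in `[0, 1] -> ball x r (l t).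
    rewrite in_itv/= => /andP[t0 t1]; move: xy; rewrite -!ball_normE /ball_ /=.
    rewrite /l opprD addrCA subrr addr0 normrN normrZ ger0_norm//.
    by apply: le_lt_trans; rewrite distrC ler_piMl.
  have dl t : differentiable l t.
    by apply: differentiableD => //; apply: (differentiableZl (y - x)).
  have dFl (t : R) : t \in `[0, 1] -> is_derive t 1 (F \o l) 0.
    move=> /lb/dF[dF1 dF2].
    have dc : differentiable (F \o l) t by exact: differentiable_comp.
    by split; [exact/derivable1_diffP|rewrite deriveE// diff_comp//= dF2].
  have dFo (t : R) : t \in `]0, 1[%R -> is_derive t 1 (F \o l) ((fun=> 0 : R) t).
    by move=> t01; apply: dFl; exact: subset_itv_oo_cc.
  have cF : {within `[0 : R, 1], continuous (F \o l)}.
    apply: continuous_in_subspaceT => t /set_mem/= t01.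
    by have [d _] := dFl t t01; exact/differentiable_continuous/derivable1_diffP.
  have [t _] := MVT_segment ler01 dFo cF.
  rewrite mul0r /= /l scale1r scale0r subrK add0r => /eqP.
  by rewrite subr_eq0 => /eqP.
have nb : \forall q \near p, ball (cfun c p) r (cfun c q).
  by apply: (cfun_cts cp); exact: nbhsx_ballx.
have nc : \forall q \near p, cdom c q.
  by apply: open_nbhs_nbhs; split=> //; exact: cdom_open.
near=> q; have qc : cdom c q by near: q.
have : F (cfun c q) = F (cfun c p) by apply: Fcst; near: q.
by rewrite /F /= !cfunK.
Unshelve. all: by end_near. Qed.

(** Inside [W] every preimage under [f] is open, so the fibre through [z] is open and closed
    relative to [W], and nonempty. *)
Lemma connected_locally_constant (T : topologicalType) (Y : Type) (f : T -> Y)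
    (W : set T) : open W -> connected W ->
  (forall z, W z -> \forall w \near z, f w = f z) ->
  forall z w, W z -> W w -> f w = f z.
Proof.
move=> oW cW lf z w Wz Ww.
have oP (P : set Y) : open (W `&` f @^-1` P).
  rewrite openE => x [Wx Px]; near=> y; split.
    by near: y; exact: open_nbhs_nbhs.
  by rewrite /preimage /= (_ : f y = f x) //; near: y; exact: lf.
suff BW : W `&` f @^-1` [set f z] = W by move: Ww; rewrite -{1}BW => -[].
apply: cW.
- by exists z.
- exists (W `&` f @^-1` [set f z]); first exact: oP.
  by rewrite setIA setIid.
exists (~` (W `&` f @^-1` (~` [set f z]))); first exact/open_closedC/oP.
apply/seteqP; split=> x [Wx] /=; first by move=> fx; split=> // -[_].
by move=> nx; split=> //; apply: contrapT => fx; apply: nx.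
Unshelve. all: by end_near. Qed.
End smooth_functions.

(** * Product manifolds *)

Section product.
Context {R : realType} {M1 M2 : topologicalType} {E1 E2 : normedModType R}.
Variables (S1 : smooth_manifold M1 E1) (S2 : smooth_manifold M2 E2).
Local Notation S := (manifold_prod S1 S2).

Lemma smooth_fun_fst h : smooth_fun S1 h -> smooth_fun S (fun x => h x.1).
Proof.
move=> sh _ [c1 a1 [c2 a2 ->]] k.
by apply: (Ck_subset _ (Ck_comp_fst E2 (sh c1 a1 k))) => x [].
Qed.

Lemma smooth_fun_snd h : smooth_fun S2 h -> smooth_fun S (fun x => h x.2).
Proof.
move=> sh _ [c1 a1 [c2 a2 ->]] k.
by apply: (Ck_subset _ (Ck_comp_snd E1 (sh c2 a2 k))) => x [].
Qed.

(** The preferred charts of the product are products of those of the factors, so in charts the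
    pull-back is composition with the linear map [fst]. *)
Lemma differential_fst h z u : smooth_fun S1 h ->
  differential S (fun x => h x.1) z u = differential S1 h z.1 u.1.
Proof.
move=> sh; have [a d] := (chart_at_atlas S1 z.1, chart_at_dom S1 z.1).
have dh := smooth_fun_differentiable sh a d.
have cf : continuous (fst : E1 * E2 -> E1) by move=> x; exact: cvg_fst.
have df x : differentiable (fst : E1 * E2 -> E1) x by exact: linear_differentiable.
rewrite /differential.
have := @diff_comp _ _ _ _ fst (h \o cinv (chart_at S1 z.1))
  (cfun (chart_at S1 z.1) z.1, cfun (chart_at S2 z.2) z.2) (df _) dh.
by move=> /(congr1 (@^~ u)) /= ->; rewrite diff_lin.
Qed.

Lemma differential_snd h z u : smooth_fun S2 h ->
  differential S (fun x => h x.2) z u = differential S2 h z.2 u.2.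
Proof.
move=> sh; have [a d] := (chart_at_atlas S2 z.2, chart_at_dom S2 z.2).
have dh := smooth_fun_differentiable sh a d.
have cf : continuous (snd : E1 * E2 -> E2) by move=> x; exact: cvg_snd.
have df x : differentiable (snd : E1 * E2 -> E2) x by exact: linear_differentiable.
rewrite /differential.
have := @diff_comp _ _ _ _ snd (h \o cinv (chart_at S2 z.2))
  (cfun (chart_at S1 z.1) z.1, cfun (chart_at S2 z.2) z.2) (df _) dh.
by move=> /(congr1 (@^~ u)) /= ->; rewrite diff_lin.
Qed.
End product.

(** * Lifts acting on sums of functions of the factors *)

Section lifts.
Context {R : realType} {M1 M2 : topologicalType} {n1 n2 : nat}.
Variables (S1 : smooth_manifold M1 'rV[R]_n1) (S2 : smooth_manifold M2 'rV[R]_n2).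
Local Notation S := (manifold_prod S1 S2).

Lemma vf_apply_hlift X h1 h2 z : smooth_fun S1 h1 -> smooth_fun S2 h2 ->
  vf_apply S (hlift X) (fun x => h1 x.1 + h2 x.2) z = vf_apply S1 X h1 z.1.
Proof.
move=> s1 s2; rewrite /vf_apply.
rewrite (differentialD _ _ (smooth_fun_fst s1) (smooth_fun_snd s2)).
by rewrite differential_fst// differential_snd// /hlift /= [X in _ + X]linear0 addr0.
Qed.

Lemma vf_apply_vlift U h1 h2 : smooth_fun S1 h1 -> smooth_fun S2 h2 ->
  vf_apply S (vlift U) (fun x => h1 x.1 + h2 x.2) = (fun z => vf_apply S2 U h2 z.2).
Proof.
move=> s1 s2; apply/funext => z; rewrite /vf_apply.
rewrite (differentialD _ _ (smooth_fun_fst s1) (smooth_fun_snd s2)).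
by rewrite differential_fst// differential_snd// /vlift /= [X in X + _]linear0 add0r.
Qed.

(** [U(h1 + h2)] is the pull-back of the smooth function [U(h2)] on the second factor, which a
    horizontal lift annihilates. *)
Lemma vf_apply_hlift_vlift X U h1 h2 z : smooth_vector_field S2 U ->
  smooth_fun S1 h1 -> smooth_fun S2 h2 ->
  vf_apply S (hlift X) (vf_apply S (vlift U) (fun x => h1 x.1 + h2 x.2)) z = 0.
Proof.
move=> sU s1 s2; rewrite vf_apply_vlift// {1}/vf_apply differential_snd.
  by rewrite /hlift /= [LHS]linear0.
exact: smooth_vf_apply.
Qed.
End lifts.

(** * The mixed equation as a product, and constancy of [k1 + sigma1] *)

Unset Implicit Arguments.
Set Strict Implicit.
Set Printing Implicit Defensive.

Theorem theorem4p5 (R : realType) (n1 n2 : nat) (M1 M2 : topologicalType)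
    (S1 : smooth_manifold M1 'rV[R]_n1) (S2 : smooth_manifold M2 'rV[R]_n2)
    (L : lyra_twisted_product S1 S2)
    (k1 sigma1 : M1 -> R) (k2 sigma2 : M2 -> R) :
  (0 < n1)%N -> (0 < n2)%N -> (2 < n1 + n2)%N ->
  smooth_fun S1 k1 -> smooth_fun S1 sigma1 ->
  smooth_fun S2 k2 -> smooth_fun S2 sigma2 ->
  (forall z, ln (twist L z) = k1 z.1 + k2 z.2) ->
  (forall z, ln (scale L z) = sigma1 z.1 + sigma2 z.2) ->
  (mixed_soliton_equation L <->
   (forall (X : M1 -> 'rV[R]_n1) (U : M2 -> 'rV[R]_n2),
      smooth_vector_field S1 X -> smooth_vector_field S2 U ->
      forall p q, vf_apply S1 X (fun x => k1 x + sigma1 x) p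
                  * vf_apply S2 U sigma2 q = 0))
  /\
  (mixed_soliton_equation L ->
   let d := differential (manifold_prod S1 S2) in
   forall W : set (M1 * M2), open W -> connected W ->
     (forall z, W z -> d (fun x => sigma2 x.2) z <> cst 0) ->
     (forall z, W z -> d (fun x => k1 x.1 + sigma1 x.1) z = cst 0)
     /\
     (exists C : R,
        (forall z, W z -> k1 z.1 + sigma1 z.1 = C) /\
        (forall z, W z -> expR (k1 z.1) * expR (sigma1 z.1) = expR C))).
Proof.
move=> _ _ n_gt2 sk1 ss1 sk2 ss2 kE sE.
have sks := smooth_funD sk1 ss1.
(* Once the second-order terms vanish, [U(sigma2)] factors out of the two remaining products. The
   identity holds for each pair of fields at each point and serves both directions. *)
have mixedE X U z : smooth_vector_field S2 U ->
    let D := vf_apply (manifold_prod S1 S2) in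
    let k := fun z => ln (twist L z) in
    let sigma := fun z => ln (scale L z) in
    (n2%:R - 1) * D (hlift X) (D (vlift U) k) z
    + ((n1 + n2)%:R - 2) * (D (hlift X) (D (vlift U) sigma) z
                    - D (hlift X) k z * D (vlift U) sigma z
                    - D (hlift X) sigma z * D (vlift U) sigma z) =
    - ((n1 + n2)%:R - 2) * (vf_apply S1 X (fun x => k1 x + sigma1 x) z.1
                             * vf_apply S2 U sigma2 z.2).
  move=> sU D k sigma; rewrite /k /sigma (funext kE) (funext sE) /D.
  rewrite !vf_apply_hlift_vlift// !vf_apply_hlift// vf_apply_vlift//.
  have -> : vf_apply S1 X (fun x => k1 x + sigma1 x) z.1 =
      vf_apply S1 X k1 z.1 + vf_apply S1 X sigma1 z.1 by exact: differentialD.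
  by rewrite mulr0 add0r; ring.
have n_neq2 : - ((n1 + n2)%:R - 2) != 0 :> R.
  by rewrite oppr_eq0 subr_eq0 eqr_nat gtn_eqF.
(* The second claim can then be derived from the product equation instead of the mixed one. *)
have iff_imp (A B C : Prop) :
  (A <-> B) -> (B -> C) -> (A <-> B) /\ (A -> C) by move=> [AB BA] BC; split=> // /AB.
apply: iff_imp.
  split=> [mix X U sX sU p q|XU n k sigma D X U sX sU z].
    have /eqP := etrans (esym (mixedE X U (p, q) sU)) (mix X U sX sU (p, q)).
    by rewrite mulf_eq0 (negPf n_neq2) => /eqP.
  by apply: etrans (mixedE X U z sU) _; rewrite XU ?mulr0.
move=> XU d W oW cW dW.
have dks z : W z -> d (fun x => k1 x.1 + sigma1 x.1) z = cst 0 :> (_ -> R).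
  move=> Wz; apply/funext => v.
  rewrite [LHS](differential_fst _ (h := fun x => k1 x + sigma1 x))//=.
  (* If [d(k1 + sigma1)] were nonzero on [v], the product equation would force [d sigma2] to vanish
     on every [u], against [dW]. *)
  apply: contrapT => dv; apply: (dW z Wz); apply/funext => u.
  rewrite [LHS](differential_snd _ (h := sigma2))//=.
  (* The product equation is stated for global fields; these take the prescribed values at the point
     [z]. *)
  have [X sX Xv] := exists_smooth_vector_field S1 z.1 v.1.
  have [U sU Uu] := exists_smooth_vector_field S2 z.2 u.2.
  have /eqP := XU X U sX sU z.1 z.2; rewrite /vf_apply Xv Uu mulf_eq0.
  by case/orP => /eqP.
split; first exact: dks.
(* The empty set counts as connected; there any constant will do, and 0 is taken. *)
have [[z Wz]|W0] := pselect (exists z, W z); last first.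
  by exists 0; split=> z Wz; case: W0; exists z.
exists (k1 z.1 + sigma1 z.1).
have cst w : W w -> k1 w.1 + sigma1 w.1 = k1 z.1 + sigma1 z.1.
  apply: (connected_locally_constant (f := fun x => k1 x.1 + sigma1 x.1)) => //.
  have sks12 := @smooth_fun_fst _ _ _ _ _ _ S2 _ sks.
  exact: (differential_locally_constant sks12 oW dks).
by split=> // w Ww; rewrite -expRD cst.
Qed.
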